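(* Let $T:\mathbb{C}[x_1,\dots,x_d]\to\mathbb{C}$ be a pseudo-positive definite functional. If all component functionals $T_{k,l}:\mathbb{C}[t]\to\mathbb{C}$, $k\in\mathbb{N}_0$, $l=1,\dots,a_k$, are determined in the sense of Stieltjes, then there exists at most one pseudo-positive, signed moment measure $\mu$ on $\mathbb{R}^d$ with $$T(f)=\int_{\mathbb{R}^d}f\,d\mu\qquad\text{for all } f\in\mathbb{C}[x_1,\dots,x_d].$$
   Context: Fix an integer $d\ge 2$. $|x|$ is the Euclidean norm and $\mathbb{S}^{d-1}$ the unit sphere of $\mathbb{R}^d$ with surface measure $d\theta$. For each $k\in\mathbb{N}_0=\{0,1,2,\dots\}$, $Y_{k,1},\dots,Y_{k,a_k}:\mathbb{R}^d\to\mathbb{R}$ is a fixed basis of the space of harmonic homogeneous polynomials of degree $k$, orthonormal with respect to $\langle f,g\rangle=\int_{\mathbb{S}^{d-1}}f(\theta)\overline{g(\theta)}\,d\theta$. For a linear functional $T:\mathbb{C}[x_1,\dots,x_d]\to\mathbb{C}$ the component functionals are $T_{k,l}(p):=T(p(|x|^2)Y_{k,l}(x))$, $p\in\mathbb{C}[t]$. $T$ is pseudo-positive definite if $T_{k,l}(p^*(t)p(t))\ge0$ and $T_{k,l}(t\,p^*(t)p(t))\ge0$ for all $k,l$ and all $p\in\mathbb{C}[t]$, where $p^*$ has the complex conjugate coefficients of $p$. A functional $\phi$ on $\mathbb{C}[t]$ is determined in the sense of Stieltjes if there is exactly one non-negative measure $\tau$ on $[0,\infty)$ with all moments finite such that $\int_0^\infty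 t^m\,d\tau(t)=\phi(t^m)$ for all $m\in\mathbb{N}_0$. A signed measure on $\mathbb{R}^d$ is a real-valued $\sigma$-additive set function on the Borel sets; it is a moment measure if all polynomials are integrable with respect to its total variation. A signed measure $\mu$ is pseudo-positive if $\int_{\mathbb{R}^d}h(|x|)Y_{k,l}(x)\,d\mu(x)\ge0$ for every continuous compactly supported $h:[0,\infty)\to[0,\infty)$ and all $k,l$. *)

(* Defs.v *)
From HB Require Import structures.
From mathcomp Require Import all_boot all_order all_algebra.
(* mpoly clashes with the analysis library: with its notations, and with names
   such as [isMeasure], which the import order leaves to the latter. *)
From mathcomp Require Import -(notations) mpoly.
From mathcomp Require Import all_classical all_reals all_analysis.
From mathcomp Require Import measurable_realfun.
From mathcomp Require Import complex.

Set Implicit Arguments.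
Unset Strict Implicit.
Unset Printing Implicit Defensive.

Import Order.TTheory GRing.Theory Num.Theory.
Import numFieldNormedType.Exports.

Local Open Scope classical_set_scope.
Local Open Scope ring_scope.

Notation borel_rV R d := (g_sigma_algebraType (@open 'rV[R]_d)).

(* The library norm on ['rV[R]_d] is the sup norm. *)
Definition enorm (R : realType) (d : nat) (x : 'rV[R]_d) : R :=
  Num.sqrt (\sum_(i < d) x 0 i ^+ 2).

Section borel_rV_measurability.
Context (R : realType) (d : nat).

Lemma measurable_coord_rV (i : 'I_d) :
  measurable_fun [set: borel_rV R d]
    (fun x : borel_rV R d => (x : 'rV[R]_d) 0 i : measurableTypeR R).
Proof.
move=> mT; apply: (measurability _ (RGenOInfty.measurableE R)) => //.
move=> _ [_ [a ->] <-].
rewrite setTI; apply: sub_sigma_algebra.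
apply: (@open_comp _ _ (fun x : 'rV[R]_d => x 0 i)).
  by move=> x _; exact: coord_continuous.
exact: interval_open.
Qed.

Lemma measurable_fun_rVP (dT : measure_display) (T : measurableType dT)
    (f : T -> 'rV[R]_d) :
  (forall i, measurable_fun [set: T] (fun t => f t 0 i : measurableTypeR R)) ->
  measurable_fun [set: T] (f : T -> borel_rV R d).
Proof.
move=> mf mT; apply: (@measurability _ _ _ (borel_rV R d) _ _ (@open 'rV[R]_d)) => //.
move=> _ [U oU <-]; rewrite setTI.
pose box (q : 'rV[rat]_d * nat) : set 'rV[R]_d :=
  [set x | forall i, ball (ratr (q.1 0 i) : R) q.2.+1%:R^-1 (x 0 i)].
pose Q := [set q | box q `<=` U].
have -> : f @^-1` U = \bigcup_(q in Q) (f @^-1` box q).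
  apply/seteqP; split=> [t Uft|t [q Qq]]; last exact: Qq.
  have /nbhs_ballP[e /= e0 eU] : nbhs (f t) U by exact: open_nbhs_nbhs.
  have [k ke] : exists k : nat, k.+1%:R^-1 < e / 2.
    have e2 : 0 < e / 2 by rewrite divr_gt0.
    exists (Num.bound (e / 2)^-1).
    rewrite invf_plt ?posrE ?ltr0n//.
    have /archi_boundP/lt_le_trans -> // : 0 <= (e / 2)^-1 by rewrite invr_ge0 ltW.
    by rewrite ler_nat.
  have k0 : 0 < k.+1%:R^-1 :> R by rewrite invr_gt0 ltr0n.
  have qP (i : 'I_d) : {q : rat | ball (ratr q : R) k.+1%:R^-1 (f t 0 i)}.
    apply: cid; have [|q] := @rat_in_itvoo R (f t 0 i) (f t 0 i + k.+1%:R^-1).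
      by rewrite ltrDl.
    rewrite in_itv/= => /andP[q1 q2]; exists q.
    by rewrite /ball/= ger0_norm ?subr_ge0 1?ltW// ltrBlDl.
  exists (\row_i sval (qP i), k) => [x /= xq|i]; last first.
    by rewrite mxE; exact: (svalP (qP i)).
  apply: eU; split => // i j; rewrite (ord1 i).
  have := xq j; rewrite mxE; have := svalP (qP j); rewrite /ball/= => h1 h2.
  rewrite (splitr e); apply: (le_lt_trans (ler_distD (ratr (sval (qP j))) _ _)).
  by rewrite distrC ltrD// (lt_trans _ ke).
rewrite bigcup_mkcond; apply: countable_bigcupT_measurable; first exact: countableP.
move=> q; case: ifPn => // _.
rewrite (_ : _ @^-1` _ = \bigcap_(i in [set: 'I_d])
    ((fun t => f t 0 i) @^-1` ball (ratr (q.1 0 i) : R) q.2.+1%:R^-1)).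
  apply: fin_bigcap_measurable => [|i _]; first exact: finite_finset.
  by rewrite -[X in measurable X]setTI; apply: mf => //; exact: measurable_ball.
by apply/seteqP; split=> t /= h i; [move=> _|]; exact: h.
Qed.

Lemma measurable_enorm :
  measurable_fun [set: borel_rV R d] (@enorm R d : _ -> measurableTypeR R).
Proof.
apply: (@measurableT_comp _ _ _ _ _ _ (@Num.sqrt R)).
  by apply: continuous_measurable_fun; exact: sqrt_continuous.
by apply: measurable_sum => i; apply: measurable_funX; exact: measurable_coord_rV.
Qed.

End borel_rV_measurability.

Section image_measure.
Local Open Scope ereal_scope.
Context d1 d2 (T1 : measurableType d1) (T2 : measurableType d2) (R : realType).
Context (f : T1 -> T2) (mf : measurable_fun [set: T1] f).
Context (m : {measure set T1 -> \bar R}).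

Let map := pushforward m f.

Let map0 : map set0 = 0. Proof. exact: measure0. Qed.

Let map_ge0 A : 0 <= map A. Proof. exact: measure_ge0. Qed.

Let map_sigma_additive : semi_sigma_additive map.
Proof. exact: measure_semi_sigma_additive. Qed.

HB.instance Definition _ := isMeasure.Build _ _ _ map
  map0 map_ge0 map_sigma_additive.

Definition image_measure : {measure set T2 -> \bar R} := map.

End image_measure.

Section lebesgue_tuple.
Context (R : realType).
Local Notation T n := (n.-tuple (measurableTypeR R)).

Definition consp n (xt : measurableTypeR R * T n) : T n.+1 :=
  [tuple of xt.1 :: xt.2].

Lemma measurable_consp n : measurable_fun [set: measurableTypeR R * T n] (@consp n).
Proof. exact: measurable_cons. Qed.

Section step.
Context (n : nat) (m : {sigma_finite_measure set (T n) -> \bar R}).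

Definition lebesgue_cons : set (T n.+1) -> \bar R :=
  image_measure (@measurable_consp n) (@lebesgue_measure R \x m)%E.

HB.instance Definition _ := Measure.on lebesgue_cons.

Let lebesgue_cons_sigma_finite : sigma_finite [set: T n.+1] lebesgue_cons.
Proof.
have [F FT Ffin] : sigma_finite setT (@lebesgue_measure R \x m)%E.
  have /sigma_finiteP[A [AT ndA Afin]] := sigma_finiteT (@lebesgue_measure R).
  have /sigma_finiteP[B [BT ndB Bfin]] := sigma_finiteT m.
  exists (fun k => A k `*` B k).
    rewrite -setXTT AT BT; apply/seteqP; split=> -[x y] /=.
      move=> [[i _ Ai] [j _ Bj]]; exists (maxn i j) => //; split.
        by move: Ai; exact/subsetPset/ndA/leq_maxl.
      by move: Bj; exact/subsetPset/ndB/leq_maxr.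
    by move=> [k _ [Ak Bk]]; split; exists k.
  move=> k; have [mA lA] := Afin k; have [mB lB] := Bfin k.
  split; first exact: measurableX.
  by rewrite product_measure1E// lte_mul_pinfty// ge0_fin_numE.
pose g (t : T n.+1) : measurableTypeR R * T n := (thead t, [tuple of behead t]).
have Kg xt : g (consp xt) = xt.
  by case: xt => x t; congr pair; apply/val_inj.
have mg : measurable_fun [set: T n.+1] g.
  apply: measurable_fun_pair; first exact: measurable_tnth.
  exact: measurable_behead.
exists (fun k => g @^-1` F k).
  by rewrite -preimage_bigcup -FT preimage_setT.
move=> k; have [mFk Fk] := Ffin k; split.
  by rewrite -[X in measurable X]setTI; exact: mg.
rewrite /lebesgue_cons /= /pushforward; congr (_ < _)%E: Fk; congr (_ _).
by apply/seteqP; split=> xt /=; rewrite Kg.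
Qed.

HB.instance Definition _ :=
  Measure_isSigmaFinite.Build _ _ _ lebesgue_cons lebesgue_cons_sigma_finite.

End step.

Fixpoint lebesgue_tuple (n : nat) : {sigma_finite_measure set (T n) -> \bar R} :=
  if n is n'.+1 then lebesgue_cons (lebesgue_tuple n')
  else dirac ([tuple] : T 0).

End lebesgue_tuple.

Section surface_measure.
Context (R : realType) (d : nat).

Definition row_of_tuple (t : d.-tuple (measurableTypeR R)) : borel_rV R d :=
  (\row_(i < d) tnth t i : 'rV[R]_d).

Lemma measurable_row_of_tuple : measurable_fun setT row_of_tuple.
Proof.
apply: measurable_fun_rVP => i.
rewrite (_ : (fun _ => _) = (fun t : d.-tuple (measurableTypeR R) => tnth t i)).
  exact: measurable_tnth.
by apply/funext => t; rewrite mxE.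
Qed.

Definition lebesgue_rV : {measure set (borel_rV R d) -> \bar R} :=
  image_measure measurable_row_of_tuple (lebesgue_tuple R d).

Definition radial_proj (x : borel_rV R d) : borel_rV R d :=
  ((enorm x)^-1 *: (x : 'rV[R]_d)).

Lemma measurable_radial_proj : measurable_fun setT radial_proj.
Proof.
apply: measurable_fun_rVP => i.
rewrite (_ : (fun _ => _) = fun x : borel_rV R d =>
    (enorm x `^ (-1) * (x : 'rV[R]_d) 0 i : measurableTypeR R)).
  apply: measurable_funM; last exact: measurable_coord_rV.
  by apply: (measurableT_comp (measurable_powR _)); exact: measurable_enorm.
by apply/funext => x; rewrite mxE powR_inv1 ?sqrtr_ge0.
Qed.

Definition punctured_ball : set (borel_rV R d) :=
  [set x | 0 < enorm x <= 1].

Lemma measurable_punctured_ball : measurable punctured_ball.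
Proof.
rewrite (_ : punctured_ball = (@enorm R d) @^-1` `]0, 1]).
  by rewrite -[X in measurable X]setTI; apply: measurable_enorm.
by apply/seteqP; split => x /=; rewrite in_itv.
Qed.

(** The surface measure of the unit sphere, seen as a measure on R^d: the set
    [A] has mass [d] times the volume of the cone
    [{x | 0 < |x| <= 1 /\ x / |x| \in A}]. *)
Definition sphere_measure : {measure set (borel_rV R d) -> \bar R} :=
  mscale d%:R%:nng (image_measure measurable_radial_proj
    (mrestr lebesgue_rV measurable_punctured_ball)).

End surface_measure.

Section integrals.
Context (dT : measure_display) (T : measurableType dT) (R : realType).

Definition cintegral (m : {measure set T -> \bar R}) (f : T -> R[i]) : R[i] :=
  ((\int[m]_x complex.Re (f x)) +i* (\int[m]_x complex.Im (f x)))%C.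

Definition cintegrable (m : {measure set T -> \bar R}) (f : T -> R[i]) : Prop :=
  m.-integrable setT (fun x => (complex.Re (f x))%:E) /\
  m.-integrable setT (fun x => (complex.Im (f x))%:E).

Variable mu : {charge set T -> \bar R}.

Lemma hahn_sig : {PN : set T * set T | hahn_decomposition mu PN.1 PN.2}.
Proof.
by apply: cid; have [P [N PN]] := Hahn_decomposition mu; exists (P, N).
Qed.

Definition total_variation : {measure set T -> \bar R} :=
  charge_variation (svalP hahn_sig).

(* Any two Hahn decompositions give the same Jordan parts on measurable sets. *)
Definition charge_integral (f : T -> R) : R :=
  \int[jordan_pos (svalP hahn_sig)]_x f x -
  \int[jordan_neg (svalP hahn_sig)]_x f x.

Definition charge_cintegral (f : T -> R[i]) : R[i] :=
  (charge_integral (fun x => complex.Re (f x)) +i*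
   charge_integral (fun x => complex.Im (f x)))%C.

End integrals.

Section polynomials.
Context (R : realType) (d : nat).
Implicit Types (p f : mpoly d R[i]) (y : mpoly d R).

Definition reval y (x : 'rV[R]_d) : R := meval (fun i => x 0 i) y.

Definition ceval f (x : 'rV[R]_d) : R[i] := meval (fun i => (x 0 i)%:C%C) f.

Definition to_cpoly y : mpoly d R[i] := map_mpoly (fun c => c%:C%C) y.

Definition laplacian f : mpoly d R[i] := \sum_(i < d) mderiv i (mderiv i f).

Definition harmonic_homogeneous (k : nat) f : Prop :=
  f \is ishomog1 k (@mdeg d) /\ laplacian f = 0.

Definition sphere_inner f g : R[i] :=
  cintegral (sphere_measure R d) (fun x => ceval f x * Num.conj (ceval g x)).

Definition harmonic_orthonormal_basis (k a : nat) (Y : 'I_a -> mpoly d R) : Prop :=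
  [/\ forall l, harmonic_homogeneous k (to_cpoly (Y l)),
      forall f, harmonic_homogeneous k f ->
        exists c : 'I_a -> R[i], f = \sum_(l < a) c l *: to_cpoly (Y l),
      forall c : 'I_a -> R[i],
        \sum_(l < a) c l *: to_cpoly (Y l) = 0 -> forall l, c l = 0
    & forall l m, sphere_inner (to_cpoly (Y l)) (to_cpoly (Y m)) = (l == m)%:R].

Definition sqnorm_poly : mpoly d R[i] := \sum_(i < d) mpolyX R[i] (mnm1 i) ^+ 2.

(** The polynomial [p(|x|^2)]. *)
Definition radial_poly (p : {poly R[i]}) : mpoly d R[i] :=
  (map_poly (@mpolyC d R[i]) p).[sqnorm_poly].

Definition component (T : {scalar mpoly d R[i]}) y (p : {poly R[i]}) : R[i] :=
  T (radial_poly p * to_cpoly y).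

End polynomials.

Definition conj_poly (R : realType) (p : {poly R[i]}) : {poly R[i]} :=
  map_poly (@Num.conj R[i]) p.

(* [0 <= z] in [R[i]] means that [z] is a nonnegative real. *)
Definition pseudo_positive_definite (R : realType) (d : nat) (a : nat -> nat)
    (Y : forall k, 'I_(a k) -> mpoly d R) (T : {scalar mpoly d R[i]}) : Prop :=
  forall (k : nat) (l : 'I_(a k)) (p : {poly R[i]}),
    0 <= component T (Y k l) (conj_poly p * p) /\
    0 <= component T (Y k l) ('X * (conj_poly p * p)).

Section stieltjes.
Context (R : realType).

(* Measures on [0, +oo[ are Borel measures on R vanishing on ]-oo, 0[. *)
Definition stieltjes_representing (phi : {poly R[i]} -> R[i])
    (tau : {measure set (measurableTypeR R) -> \bar R}) : Prop :=
  tau `]-oo, 0[%classic = 0%E /\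
  forall m : nat,
    tau.-integrable `[0, +oo[ (fun t => (t ^+ m)%:E) /\
    ((\int[tau]_(t in `[0, +oo[) t ^+ m)%:C)%C = phi 'X^m.

Definition stieltjes_determined (phi : {poly R[i]} -> R[i]) : Prop :=
  exists2 tau : {measure set (measurableTypeR R) -> \bar R},
    stieltjes_representing phi tau &
    forall tau' : {measure set (measurableTypeR R) -> \bar R},
      stieltjes_representing phi tau' ->
      forall A, measurable A -> tau' A = tau A.

End stieltjes.

Section signed_measures.
Context (R : realType) (d : nat).
Variable mu : {charge set (borel_rV R d) -> \bar R}.

Definition moment_measure : Prop :=
  forall f : mpoly d R[i], cintegrable (total_variation mu) (ceval f).

(* Only the values of [h] on [0, +oo[ matter. *)
Definition pseudo_positive (a : nat -> nat)
    (Y : forall k, 'I_(a k) -> mpoly d R) : Prop :=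
  forall (h : R -> R) (k : nat) (l : 'I_(a k)),
    {within `[0, +oo[, continuous h} ->
    (forall t, 0 <= t -> 0 <= h t) ->
    compact (closure ([set t | h t != 0] `&` `[0, +oo[)) ->
    0 <= charge_integral mu (fun x => h (enorm x) * reval (Y k l) x).

Definition represents (T : {scalar mpoly d R[i]}) : Prop :=
  forall f : mpoly d R[i], T f = charge_cintegral mu (ceval f).

End signed_measures.

(* Main.v *)
(** Let [mu] be a solution and [s = |x|^2].  By pseudo-positivity, the image under
    [s] of the signed measure [Y_{k,l} mu] is a nonnegative measure on [[0, +oo[],
    and its moments are those of [T_{k,l}]; determinacy thus makes it independent
    of [mu].  As every polynomial is a sum of terms [|x|^{2j} H] with [H] harmonic,
    two solutions have the same moments on every ball [{|x|^2 <= M}].  There,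
    indicators of half-spaces are bounded pointwise limits of polynomials, so the
    two solutions agree on all intersections of a ball with finitely many
    half-spaces, a pi-system which generates the Borel sets. *)
From HB Require Import structures.
Require Import Defs.
From mathcomp Require Import all_boot all_order all_algebra.
From mathcomp Require Import -(notations) mpoly.
From mathcomp Require Import all_classical all_reals all_analysis.
From mathcomp Require Import complex measurable_realfun ring lra zify.

Set Implicit Arguments.
Unset Strict Implicit.
Unset Printing Implicit Defensive.

Import Order.TTheory GRing.Theory Num.Theory.
Import numFieldNormedType.Exports.
Local Open Scope classical_set_scope.
Local Open Scope ring_scope.

(** Equal moments need not force equality of measures on an unbounded space, and the moment problem
    of the signed measure itself is not assumed determinate. Determinacy therefore enters only
    radially, where it gives more than moments: once the images of [Y_{k,l} mu] and [Y_{k,l} nu]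
    under [s] coincide, the integrals of [g(s) Y_{k,l}] agree for suitable Borel weights [g >= 0],
    not only for powers. Choosing [g(t) = t^j] on [[0, M]] and 0 elsewhere localises the problem to
    a ball, where bounded polynomial approximation is available. The other obstacle is sign.
    Integrals against [mu] are differences over its Jordan parts, and positivity of [Y_{k,l} mu] is
    known only against continuous radial functions. Signed identities are therefore moved to sums of
    nonnegative measures on both sides before a uniqueness theorem is applied. *)

(** * Decomposition of polynomials into harmonic ones *)

Section harmonic_decomposition.
Context (R : realType) (d : nat).
Local Notation C := R[i].
Local Notation P := (mpoly d C).
Local Notation var i := (mpolyX C (mnm1 i) : P).
Local Notation q := (sqnorm_poly R d).
Local Notation homog k := (ishomog1 k (@mdeg d)).
Implicit Types (f g u : P) (k j : nat).

(** At [k = 0] the truncated predecessor is harmless: the derivative is 0, which is homogeneous of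
    every degree. *)
Lemma mderiv_homog (i : 'I_d) k f : f \is homog k -> mderiv i f \is homog k.-1.
Proof.
move=> /dhomogP fk; rewrite /mderiv big_seq; apply: rpred_sum => m /fk mk.
have [->|mi] := eqVneq (m i) 0%N; first by rewrite mul0r scale0r rpred0.
apply/rpredZ; rewrite dhomogX -mk; apply/eqP.
have mE : m = mnm_add (mnm_sub m (mnm1 i)) (mnm1 i).
  rewrite submK//; apply/mnm_lepP => j; rewrite mnm1E.
  by case: eqP => // <-; rewrite lt0n.
have: mdeg m = (mdeg (mnm_sub m (mnm1 i))).+1 by rewrite {1}mE mdegD mdeg1 addn1.
by move=> /= ->.
Qed.

Lemma mderiv_homog0 (i : 'I_d) f : f \is homog 0 -> mderiv i f = 0.
Proof.
move=> /dhomogP f0; rewrite /mderiv big_seq big1// => m /f0/= m0.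
have -> : m i = 0%N by move/eqP: m0; rewrite mdeg_eq0 => /eqP ->; rewrite mnm0E.
by rewrite mul0r scale0r.
Qed.

Lemma laplacian_homog k f : f \is homog k -> laplacian f \is homog k.-2.
Proof. by move=> fk; apply: rpred_sum => i _; do 2 apply: mderiv_homog. Qed.

Lemma laplacian_homog_lt2 k f : (k < 2)%N -> f \is homog k -> laplacian f = 0.
Proof.
by move=> k2 fk; apply: big1 => i _; rewrite mderiv_homog0//;
  case: k k2 fk => [|[]]// _ /(mderiv_homog i).
Qed.

Lemma euler k f : f \is homog k -> \sum_(i < d) var i * mderiv i f = k%:R *: f.
Proof.
move=> /dhomogP fk.
rewrite [in RHS](mpolyE f) scaler_sumr.
under eq_bigr do rewrite /mderiv big_distrr/=.
rewrite exchange_big/= !big_seq; apply: eq_bigr => m /fk <-.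
transitivity (\sum_(i < d) (m i)%:R *: (mcoeff m f *: mpolyX C m)).
  apply: eq_bigr => i _; rewrite -scalerAr scalerA.
  have [->|mi] := eqVneq (m i) 0%N; first by rewrite mul0r !scale0r.
  rewrite -mpolyXD addmC submK//; apply/mnm_lepP => j; rewrite mnm1E.
  by case: eqP => // <-; rewrite lt0n.
by rewrite -scaler_suml -natr_sum -mdegE.
Qed.

Lemma laplacianM f g : laplacian (f * g) =
  laplacian f * g + (\sum_(i < d) mderiv i f * mderiv i g) *+ 2 + f * laplacian g.
Proof.
rewrite /laplacian mulr_suml mulr_sumr -sumrMnl -!big_split/=.
apply: eq_bigr => i _; rewrite !(mderivM, mderivD).
ring.
Qed.

Lemma mderiv_var (i j : 'I_d) : mderiv i (var j) = (i == j)%:R.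
Proof.
rewrite mderivX mnm1E eq_sym; case: eqP => [->|_]; last by rewrite scale0r.
rewrite scale1r (_ : mnm_sub _ _ = mnm0) ?mpolyX0//.
by apply/mnmP => l; rewrite mnmBE mnm0E subnn.
Qed.

Lemma mderiv_sqnorm (i : 'I_d) : mderiv i q = var i *+ 2.
Proof.
rewrite /sqnorm_poly raddf_sum (bigD1 i)//= big1 => [|j ji].
  by rewrite expr2 mderivM mderiv_var eqxx mul1r mulr1 addr0.
by rewrite expr2 mderivM mderiv_var eq_sym (negbTE ji) mul0r mulr0 addr0.
Qed.

Lemma sqnorm_homog : q \is homog 2.
Proof.
apply: rpred_sum => i _; rewrite -[2%N]mul1n; apply: dhomogMn.
by rewrite dhomogX; apply/eqP; exact: mdeg1.
Qed.

Lemma laplacian_sqnorm : laplacian q = (2 * d)%:R.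
Proof.
rewrite /laplacian; under eq_bigr do rewrite mderiv_sqnorm raddfMn/= mderiv_var eqxx.
by rewrite sumr_const card_ord -mulrnA.
Qed.

(** The cross term of the product rule is four times the Euler operator, which multiplies [g] by
    [k]; the Laplacian of |x|^2 contributes [2 * d]. *)
Lemma laplacian_sqnormM k g : g \is homog k ->
  laplacian (q * g) = q * laplacian g + (2 * d + 4 * k)%:R *: g.
Proof.
move=> gk; rewrite laplacianM laplacian_sqnorm.
under eq_bigr do rewrite mderiv_sqnorm mulrnAl.
rewrite sumrMnl (euler gk)// !scaler_nat mulr_natl addrC -!mulrnA -mulrnDr.
by rewrite mulnC (_ : (k * (2 * 2))%N = (4 * k)%N)// mulnC.
Qed.

(** The constant is left existential because only its positivity matters: it will be inverted. *)
Lemma laplacian_sqnormXM (d0 : (0 < d)%N) k g (gk : g \is homog k) j :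
  exists2 c : nat, (0 < c)%N &
    laplacian (q ^+ j.+1 * g) = q ^+ j.+1 * laplacian g + c%:R *: (q ^+ j * g).
Proof.
elim: j => [|j [c c0 cE]].
  exists (2 * d + 4 * k)%N; first by lia.
  by rewrite expr1 (@laplacian_sqnormM k)// expr0 mul1r.
exists (c + (2 * d + 4 * (2 * j.+1 + k)))%N; first by rewrite addn_gt0 c0.
rewrite exprS -mulrA (@laplacian_sqnormM (2 * j.+1 + k)); last first.
  by apply: dhomogM => //; apply: dhomogMn; exact: sqnorm_homog.
by rewrite cE mulrDr -scalerAr !mulrA -!exprS -!addrA -!scalerDl -!natrD.
Qed.

(* Solved by the ansatz [u = c (|x|^{2j} g - v)]: [Delta] turns [|x|^{2j+2} g]
   into a multiple of [|x|^{2j} g] plus a term of the same shape in [Delta g]. *)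
Lemma laplacian_sqnorm_surj (d0 : (0 < d)%N) k g (gk : g \is homog k) j :
  exists2 u : P, u \is homog (k + 2 * j) & laplacian (q * u) = q ^+ j * g.
Proof.
(* [j] stays free in the induction on the degree: the correction term trades two degrees of [g] for
   one more factor |x|^2. *)
have [n] := ubnP k; elim: n k g gk j => // n IH k g gk j kn.
have [c c0 cE] := laplacian_sqnormXM d0 gk j.
have [v vk vE] : exists2 v : P, v \is homog (k + 2 * j)
    & laplacian (q * v) = q ^+ j.+1 * laplacian g.
  have [k2|k2] := ltnP k 2.
    exists 0; first exact: rpred0.
    rewrite (laplacian_homog_lt2 k2 gk) !mulr0 /laplacian big1// => i _.
    by rewrite !mderiv0.
  have [||v vk vE] := IH k.-2 (laplacian g) _ j.+1; [exact: laplacian_homog|lia|].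
  by exists v => //; rewrite (_ : k + 2 * j = k.-2 + 2 * j.+1)%N//; lia.
exists (c%:R^-1 *: (q ^+ j * g - v)).
  apply/rpredZ/rpredB => //; rewrite addnC; apply: dhomogM => //.
  by apply: dhomogMn; exact: sqnorm_homog.
rewrite -scalerAr /laplacian.
under eq_bigr do rewrite !mderivZ.
rewrite -scaler_sumr mulrBr mulrA -exprS.
under eq_bigr do rewrite !mderivB.
rewrite sumrB -!/(laplacian _) cE vE addrC addKr scalerA mulVf ?scale1r//.
by rewrite pnatr_eq0 -lt0n.
Qed.

(** Stated as an induction principle, the decomposition never has to be written out as a sum. *)
Lemma harmonic_ind (d0 : (0 < d)%N) (V : P -> Prop) :
  (forall f g, V f -> V g -> V (f + g)) ->
  (forall c f, V f -> V (c *: f)) ->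
  (forall f, V f -> V (q * f)) ->
  (forall k f, harmonic_homogeneous k f -> V f) ->
  forall f, V f.
Proof.
move=> VD VZ Vq Vh.
have V0 : V 0.
  apply: (Vh 0%N); split; first exact: rpred0.
  by apply: big1 => i _; rewrite !mderiv0.
have Vhomog k f : f \is homog k -> V f.
  have [n] := ubnP k; elim: n k f => // n IH k f kn fk.
  have [k2|k2] := ltnP k 2.
    by apply: (Vh k); split => //; exact: laplacian_homog_lt2 fk.
  (* Here [q * u] has the same Laplacian as [f], so [f - q * u] is harmonic, while [u] has degree
     [k - 2] and falls to the induction hypothesis. *)
  have [u] := laplacian_sqnorm_surj d0 (laplacian_homog fk) 0.
  rewrite expr0 mul1r muln0 addn0 => uk uE.
  rewrite -(subrK (q * u) f); apply: VD; last by apply: Vq; apply: IH uk; lia.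
  apply: (Vh k); split.
    rewrite rpredB//; have := dhomogM sqnorm_homog uk.
    by rewrite (_ : 2 + k.-2 = k)%N//; lia.
  rewrite /laplacian; under eq_bigr do rewrite !mderivB.
  by rewrite sumrB -!/(laplacian _) uE subrr.
move=> f; elim/mpolyind: f => // c m p _ _ Vp.
by apply: VD => //; apply: VZ; apply: (Vhomog (mdeg m)); rewrite dhomogX.
Qed.

End harmonic_decomposition.

(** * Image measures with a density, and dominated convergence *)

Section density.
Local Open Scope ereal_scope.
Context d1 d2 (T1 : measurableType d1) (T2 : measurableType d2) (R : realType).
Variables (P : {measure set T1 -> \bar R}) (s : T1 -> T2) (f : T1 -> R).
Hypotheses (ms : measurable_fun setT s) (mf : measurable_fun setT f).
Hypothesis f0 : forall x, (0 <= f x)%R.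

Definition weighted_image (A : set T2) : \bar R :=
  \int[P]_(x in s @^-1` A) (f x)%:E.

Let mpre (A : set T2) : measurable A -> measurable (s @^-1` A).
Proof. by move=> mA; rewrite -[X in measurable X]setTI; exact: ms. Qed.

Let weighted_image0 : weighted_image set0 = 0.
Proof. by rewrite /weighted_image preimage_set0 integral_set0. Qed.

Let weighted_image_ge0 A : 0 <= weighted_image A.
Proof. by apply: integral_ge0 => x _; rewrite lee_fin. Qed.

Let weighted_image_sigma_additive : semi_sigma_additive weighted_image.
Proof.
move=> F mF tF mUF; rewrite /weighted_image preimage_bigcup.
apply: (semi_sigma_additive_nng_induced (f := EFin \o f)) => //.
- exact/measurable_EFinP.
- by move=> n; exact: mpre.
- by apply/trivIsetP => i j _ _ ij; rewrite -preimage_setI;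
    move/trivIsetP : tF => ->//; exact: preimage_set0.
- by rewrite -preimage_bigcup; exact: mpre.
Qed.

HB.instance Definition _ := isMeasure.Build _ _ _ weighted_image
  weighted_image0 weighted_image_ge0 weighted_image_sigma_additive.

Definition weighted_image_measure : {measure set T2 -> \bar R} := weighted_image.

Import HBNNSimple.

(** Both sides are limits along increasing simple functions; on an indicator the identity is the
    definition of [weighted_image]. *)
Lemma integral_weighted_image (g : T2 -> \bar R) : measurable_fun setT g ->
  (forall t, 0 <= g t) ->
  \int[weighted_image_measure]_t g t = \int[P]_x (g (s x) * (f x)%:E).
Proof.
move=> mg g0; pose g_ := nnsfun_approx measurableT mg.
transitivity (\int[weighted_image_measure]_t lim ((g_ n t)%:E @[n --> \oo])).
  by apply/eq_integral => t _; apply/esym/cvg_lim => //=; exact: cvg_nnsfun_approx.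
rewrite monotone_convergence//; last 3 first.
  by move=> n; exact/measurable_EFinP.
  by move=> n t _; rewrite lee_fin.
  by move=> t _ a b ab; rewrite lee_fin; exact/lefP/nd_nnsfun_approx.
transitivity (\int[P]_x lim ((g_ n (s x))%:E * (f x)%:E @[n --> \oo])); last first.
  apply/eq_integral => x _; apply/cvg_lim => //=.
  by apply: cvgeZr => //; exact: cvg_nnsfun_approx.
rewrite monotone_convergence//; last 3 first.
  move=> n; apply/measurable_EFinP/measurable_funM => //.
  exact: measurableT_comp.
  by move=> n x _; rewrite lee_fin mulr_ge0.
  move=> x _ a b ab; rewrite lee_fin ler_wpM2r//; exact/lefP/nd_nnsfun_approx.
congr (lim (_ @ \oo)); apply/funext => n.
under eq_integral do rewrite fimfunE -fsumEFin//.
rewrite ge0_integral_fsum//; last 2 first.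
  - by move=> r; exact/measurable_EFinP/measurableT_comp.
  - by move=> r z _; rewrite EFinM nnfun_muleindic_ge0.
under [RHS]eq_integral => x _.
  rewrite fimfunE -fsumEFin// ge0_mule_fsuml; last first.
    by move=> r; exact: nnfun_muleindic_ge0.
  over.
rewrite ge0_integral_fsum//; last 2 first.
  - move=> r; apply: emeasurable_funM; last exact/measurable_EFinP.
    apply/measurable_EFinP/measurable_funM => //.
    exact: measurableT_comp.
  - by move=> r x _; rewrite mule_ge0 ?lee_fin//; exact: nnfun_muleindic_ge0.
apply: eq_fsbigr => r /set_mem [t _ <-].
under eq_integral do rewrite EFinM.
rewrite integralZl_indic_nnsfun// integral_indic// setIT.
under [RHS]eq_integral do rewrite EFinM -muleA.
rewrite ge0_integralZl//; last 3 first.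
- apply: emeasurable_funM; last exact/measurable_EFinP.
  apply/measurable_EFinP; exact: measurableT_comp.
- by move=> x _; rewrite mule_ge0 ?lee_fin.
- by rewrite lee_fin.
congr (_ * _); rewrite /= /weighted_image integral_mkcond.
apply: eq_integral => x _; rewrite muleC epatch_indic/=.
by rewrite indicE.
Qed.

End density.

Section dominated_Rintegral.
Context d (T : measurableType d) (R : realType) (m : {measure set T -> \bar R}).

Lemma Rintegral_dominated_cvg (f_ : nat -> T -> R) (f g : T -> R) :
  (forall n, measurable_fun setT (f_ n)) ->
  (forall x, f_ n x @[n --> \oo] --> f x) ->
  m.-integrable setT (EFin \o g) -> (forall n x, `|f_ n x| <= g x) ->
  m.-integrable setT (EFin \o f) /\
  \int[m]_x f_ n x @[n --> \oo] --> \int[m]_x f x.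
Proof.
move=> mf_ f_f ig fg.
have mf : measurable_fun setT f.
  by apply: (measurable_fun_cvg mf_) => x _; exact: f_f.
have [] := @dominated_convergence _ _ _ m setT measurableT
  (fun n => EFin \o f_ n) (EFin \o f) (EFin \o g).
- by move=> n; exact/measurable_EFinP.
- exact/measurable_EFinP.
- apply: aeW => x _; apply: cvg_EFin; last exact: f_f.
  by near=> n.
- exact: ig.
- by apply: aeW => x n _; rewrite lee_fin.
move=> If _ cv; split => //.
apply: fine_cvg; rewrite fineK//.
exact: integrable_fin_num.
Unshelve. all: by end_near. Qed.

End dominated_Rintegral.

(** * Difference of two finite measures on the line *)

Section measure_difference.
Context (R : realType).
Local Notation MR := (measurableTypeR R).
Variables (alpha beta : {finite_measure set MR -> \bar R}).
Hypothesis le_oc : forall a b : R, a <= b ->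
  (beta `]a, b]%classic <= alpha `]a, b]%classic)%E.

Let F (m : {finite_measure set MR -> \bar R}) (t : R) := fine (m `]-oo, t]%classic).

Let F_oc (m : {finite_measure set MR -> \bar R}) (a b : R) :
  a <= b -> fine (m `]a, b]%classic) = F m b - F m a.
Proof.
move=> ab; rewrite /F -fineB ?fin_num_measure//; congr fine.
have -> : `]a, b]%classic = `]-oo, b] `\` `]-oo, a] :> set R.
  by rewrite -[RHS]setCK setCD setCitvl setUC -[LHS]setCK setCitv.
rewrite measureD ?setIidr//; first exact: subset_itvl.
by rewrite -ge0_fin_numE// fin_num_measure.
Qed.

Let F_rc (m : {finite_measure set MR -> \bar R}) :
  forall a : R, F m t @[t --> a^'+] --> F m a.
Proof.
(* If [u n > a] tends to [a], the indicators of []-oo, u n]] converge pointwise to that of []-oo,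
   a]], dominated by 1. *)
move=> a; apply/cvg_at_rightP => u [ua uc].
have FE t : F m t = \int[m]_x \1_(`]-oo, t]%classic : set R) x.
  by rewrite /F /Rintegral integral_indic// setIT.
rewrite FE; under eq_cvg do rewrite FE.
have [||||_ //] := @Rintegral_dominated_cvg _ _ _ m
  (fun n => \1_(`]-oo, u n]%classic : set R)) (\1_(`]-oo, a]%classic : set R)) (cst 1).
- by [].
- move=> x; apply/cvgrPdist_lt => e e0; have [xa|ax] := leP x a.
    near=> n; rewrite !indicE !mem_setE !in_itv/= xa.
    by rewrite (le_trans xa) ?subrr ?normr0// ltW.
  near=> n; rewrite !indicE !mem_setE !in_itv/= !leNgt ax/=.
  rewrite (_ : u n < x) ?subrr ?normr0//; near: n; exact: (cvgr_lt a uc).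
- exact: finite_measure_integrable_cst.
- by move=> n x; rewrite indicE; case: (_ \in _); rewrite ?normr1 ?normr0.
Unshelve. all: by end_near. Qed.

Let G t := F alpha t - F beta t.

Let G_nd : {homo G : a b / a <= b}.
Proof.
move=> a b ab.
have : fine (beta `]a, b]%classic) <= fine (alpha `]a, b]%classic).
  by rewrite fine_le ?fin_num_measure//; exact: le_oc.
by rewrite !F_oc// /G; lra.
Qed.

Let G_rc : forall a : R, G t @[t --> a^'+] --> G a.
Proof. by move=> a; apply: cvgB; exact: F_rc. Qed.

#[local] HB.instance Definition _ := isCumulative.Build R _ R G G_nd G_rc.

Let LS_oc (a b : R) : a <= b ->
  lebesgue_stieltjes_measure G `]a, b]%classic = (G b - G a)%:E.
Proof.
move=> ab; rewrite /lebesgue_stieltjes_measure /measure_extension/=.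
by rewrite measurable_mu_extE/= ?wlength_itv_bnd//; exact: is_ocitv.
Qed.

(* [alpha - beta] is nonnegative on half-open intervals only; taking the
   Lebesgue-Stieltjes measure of its distribution function yields nonnegativity on
   all Borel sets without any regularity argument. *)
Lemma measure_difference : exists tau : {measure set MR -> \bar R},
  forall A, measurable A -> (tau A + beta A = alpha A)%E.
Proof.
exists (lebesgue_stieltjes_measure G) => A mA.
rewrite -(measure_addE (lebesgue_stieltjes_measure G) beta).
(* Half-open intervals form a generating pi-system, and the intervals []-k, k]] exhaust the line
   with finite mass. *)
refine (@measure_unique _ R MR (@ocitv R) (fun k => `](- k%:R), k%:R]%classic) _ _ _ _
  (measure_add (lebesgue_stieltjes_measure G) beta) alpha _ _ A mA) => //.
- exact: ocitvI.
- by move=> k; exact: is_ocitv.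
- apply/seteqP; split => // x _; exists (Num.bound `|x|) => //=.
  by have := archi_boundP (normr_ge0 x); rewrite ltr_norml in_itv/= => /andP[-> /ltW].
- move=> _ [[a b] _ <-]; rewrite [LHS]measure_addE /=.
  have [ba|/ltW ab] := leP b a.
    by rewrite set_itv_ge ?measure0 ?adde0// bnd_simp -leNgt.
  rewrite [X in (X + _)%E = _]LS_oc//.
  rewrite -[beta _]fineK ?fin_num_measure// -[alpha _]fineK ?fin_num_measure//.
  rewrite !F_oc// -EFinD; congr EFin; rewrite /G; ring.
- move=> k; rewrite [ltLHS]measure_addE lte_add_pinfty//; last first.
    by rewrite -ge0_fin_numE// fin_num_measure.
  by rewrite [ltLHS]LS_oc ?ltry// lerNl (@le_trans _ _ 0)// oppr_le0.
Qed.

End measure_difference.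

Section measure_of_fin_num_fun.
Context d (T : measurableType d) (R : realType) (m : {measure set T -> \bar R}).
Hypothesis fm : fin_num_fun m.

(** A copy of [m] whose type mentions the finiteness proof, so that the finite measure structure can
    be attached to it. *)
Definition measure_of_fin_num_fun (_ : fin_num_fun m) : set T -> \bar R := m.

HB.instance Definition _ := Measure.on (measure_of_fin_num_fun fm).
HB.instance Definition _ := Measure_isFinite.Build _ _ _ (measure_of_fin_num_fun fm) fm.

Definition finite_measure_of : {finite_measure set T -> \bar R} :=
  measure_of_fin_num_fun fm.

End measure_of_fin_num_fun.

(** * Image of a signed measure with density as a nonnegative measure *)

Section signed_image.
Context d (T : measurableType d) (R : realType).
Local Notation MR := (measurableTypeR R).
Variables (P N : {measure set T -> \bar R}) (s y : T -> R).
Hypotheses (ms : measurable_fun setT (s : T -> MR)) (my : measurable_fun setT y).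

Let yp x := Num.max (y x) 0.
Let yn x := Num.max (- y x) 0.

Let yE x : y x = yp x - yn x.
Proof. by rewrite /yp /yn; case: (leP (y x) 0); case: (leP (- y x) 0); lra. Qed.
Let yp0 x : 0 <= yp x. Proof. by rewrite /yp le_max lexx orbT. Qed.
Let yn0 x : 0 <= yn x. Proof. by rewrite /yn le_max lexx orbT. Qed.
Let yple x : yp x <= `|y x|.
Proof. by rewrite /yp ge_max ler_norm normr_ge0. Qed.
Let ynle x : yn x <= `|y x|.
Proof. by rewrite /yn ge_max -normrN ler_norm normr_ge0. Qed.

Let myp : measurable_fun setT yp.
Proof. exact: measurable_maxr. Qed.
Let myn : measurable_fun setT yn.
Proof. by apply: measurable_maxr => //; exact: measurableT_comp. Qed.

Let part_integrable (m : {measure set T -> \bar R}) (g z : T -> R) :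
  measurable_fun setT g -> measurable_fun setT z -> (forall x, 0 <= g x) ->
  (forall x, 0 <= z x <= `|y x|) ->
  m.-integrable setT (fun x => (g x * y x)%:E) ->
  m.-integrable setT (fun x => (g x * z x)%:E).
Proof.
move=> mg mz g0 z0; apply: le_integrable => //.
  by apply/measurable_EFinP; exact: measurable_funM.
move=> x _; have /andP[zx0 zxle] := z0 x.
by rewrite lee_fin !normrM ler_wpM2l// ger0_norm.
Qed.

(** The signed measure [y (P - N)] equals [(yp P + yn N) - (yn P + yp N)], both brackets being
    nonnegative; [alpha] and [beta] are their images under [s]. *)
Let alpha := measure_add (weighted_image_measure P ms myp yp0)
                         (weighted_image_measure N ms myn yn0).
Let beta := measure_add (weighted_image_measure P ms myn yn0)
                        (weighted_image_measure N ms myp yp0).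

Section with_weight.
Variable g : R -> R.
Hypotheses (mg : measurable_fun setT (g : MR -> R)) (g0 : forall t, 0 <= g t).
Hypothesis iP : P.-integrable setT (fun x => (g (s x) * y x)%:E).
Hypothesis iN : N.-integrable setT (fun x => (g (s x) * y x)%:E).

Let mgs : measurable_fun setT (fun x => g (s x)).
Proof. exact: measurableT_comp. Qed.

Let zp x : 0 <= yp x <= `|y x|. Proof. by rewrite yp0 yple. Qed.
Let zn x : 0 <= yn x <= `|y x|. Proof. by rewrite yn0 ynle. Qed.

Let wE (m : {measure set T -> \bar R}) (z : T -> R) (mz : measurable_fun setT z)
    (z0 : forall x, 0 <= z x) :
  (forall x, 0 <= z x <= `|y x|) ->
  m.-integrable setT (fun x => (g (s x) * y x)%:E) ->
  (\int[weighted_image_measure m ms mz z0]_t (g t)%:E =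
   (\int[m]_x (g (s x) * z x))%:E)%E.
Proof.
move=> zy im; rewrite integral_weighted_image//; last exact/measurable_EFinP.
by rewrite /Rintegral fineK// integrable_fin_num//; exact: part_integrable.
Qed.

Let RE (m : {measure set T -> \bar R}) :
  m.-integrable setT (fun x => (g (s x) * y x)%:E) ->
  \int[m]_x (g (s x) * y x) =
  \int[m]_x (g (s x) * yp x) - \int[m]_x (g (s x) * yn x).
Proof.
move=> im; rewrite -RintegralB//; [|exact: part_integrable..].
by apply: eq_Rintegral => x _; rewrite -mulrBr -yE.
Qed.

(** The real witnesses record that both integrals are finite, so that their difference makes
    sense. *)
Lemma integral_signed_image : exists a b : R,
  [/\ (\int[alpha]_t (g t)%:E = a%:E)%E, (\int[beta]_t (g t)%:E = b%:E)%E &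
  a - b = \int[P]_x (g (s x) * y x) - \int[N]_x (g (s x) * y x)].
Proof.
eexists; eexists; split.
- rewrite ge0_integral_measure_add//; 
    [|by move=> t _; rewrite lee_fin|exact/measurable_EFinP].
  by rewrite !wE// -EFinD.
- rewrite ge0_integral_measure_add//; 
    [|by move=> t _; rewrite lee_fin|exact/measurable_EFinP].
  by rewrite !wE// -EFinD.
- by rewrite !RE//; lra.
Qed.

End with_weight.

Hypotheses (iP : P.-integrable setT (EFin \o y)) (iN : N.-integrable setT (EFin \o y)).
Hypothesis le_oc : forall a b : R, a <= b ->
  0 <= \int[P]_x (\1_(`]a, b]%classic : set R) (s x) * y x) -
       \int[N]_x (\1_(`]a, b]%classic : set R) (s x) * y x).

Let indic_integrable (m : {measure set T -> \bar R}) (A : set MR) : measurable A ->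
  m.-integrable setT (EFin \o y) ->
  m.-integrable setT (fun x => (\1_A (s x) * y x)%:E).
Proof.
move=> mA; apply: le_integrable => //.
  apply/measurable_EFinP/measurable_funM => //.
  apply: (measurableT_comp (f := \1_A : MR -> R)) => //; exact: measurable_indic.
move=> x _; rewrite lee_fin normrM ler_piMl// indicE.
by case: (_ \in _); rewrite ?normr1 ?normr0.
Qed.

Let indicP (A : set MR) : measurable A -> exists a b : R,
  [/\ (alpha A = a%:E)%E, (beta A = b%:E)%E &
  a - b = \int[P]_x (\1_A (s x) * y x) - \int[N]_x (\1_A (s x) * y x)].
Proof.
move=> mA; have := @integral_signed_image (\1_A).
rewrite !integral_indic// !setIT; apply.
- exact: measurable_indic.
- by move=> t; rewrite indicE.
- exact: indic_integrable.
- exact: indic_integrable.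
Qed.

(** The hypothesis on half-open intervals says [beta <= alpha] there, so [measure_difference]
    supplies [tau] as [alpha - beta]. *)
Lemma exists_signed_image : exists tau : {measure set MR -> \bar R},
  forall g : R -> R, measurable_fun setT (g : MR -> R) -> (forall t, 0 <= g t) ->
  P.-integrable setT (fun x => (g (s x) * y x)%:E) ->
  N.-integrable setT (fun x => (g (s x) * y x)%:E) ->
  (\int[tau]_t (g t)%:E =
   (\int[P]_x (g (s x) * y x) - \int[N]_x (g (s x) * y x))%:E)%E.
Proof.
have fa : fin_num_fun alpha by move=> A /indicP[a [b [-> _ _]]].
have fb : fin_num_fun beta by move=> A /indicP[a [b [_ -> _]]].
have [a b ab|tau tauE] := @measure_difference R (finite_measure_of fa) (finite_measure_of fb).
  have [u [v [uE vE uv]]] := indicP (measurable_itv `]a, b]).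
  rewrite [leLHS]vE [leRHS]uE lee_fin -subr_ge0 uv.
  exact: le_oc.
exists tau => g mg g0 gP gN.
have [a [b [aE bE <-]]] := integral_signed_image mg g0 gP gN.
(* The integral against [beta] is finite, so it can be cancelled from [tau + beta = alpha]. *)
have : (\int[measure_add tau beta]_t (g t)%:E = \int[alpha]_t (g t)%:E)%E.
  apply: eq_measure_integral => A mA _.
  by rewrite [LHS]measure_addE; exact: tauE.
rewrite ge0_integral_measure_add//; 
    [|by move=> t _; rewrite lee_fin|exact/measurable_EFinP].
by rewrite aE bE EFinB => <-; rewrite addeK.
Qed.

End signed_image.

(** * Integration against a charge *)

Section charge_integral_theory.
Context d (T : measurableType d) (R : realType) (mu : {charge set T -> \bar R}).
Local Notation P := (jordan_pos (svalP (hahn_sig mu))).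
Local Notation N := (jordan_neg (svalP (hahn_sig mu))).
Implicit Types f g : T -> R.

(** Integrability against both Jordan parts ensures that the two real integrals are not default
    values of [fine] at infinity, as linearity requires. *)
Definition charge_integrable f :=
  P.-integrable setT (EFin \o f) /\ N.-integrable setT (EFin \o f).

Lemma charge_integrable_variation f :
  (Defs.total_variation mu).-integrable setT (EFin \o f) -> charge_integrable f.
Proof.
move=> /integrableP[mf]; rewrite (eq_measure_integral (measure_add P N)); last first.
  by move=> A mA _; rewrite [RHS]measure_addE.
rewrite ge0_integral_measure_add//; last exact: measurableT_comp.
move=> fin; split; apply/integrableP; split => //; apply: le_lt_trans fin.
  by rewrite leeDl// integral_ge0.
by rewrite leeDr// integral_ge0.
Qed.

Lemma charge_integrable_measurable f : charge_integrable f -> measurable_fun setT f.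
Proof. by move=> [/(measurable_int P)/measurable_EFinP]. Qed.

Lemma charge_integrableZ (c : R) f : charge_integrable f ->
  charge_integrable (fun x => c * f x).
Proof. by move=> [fP fN]; split;
  [exact: (integrableZl measurableT c fP)|exact: (integrableZl measurableT c fN)]. Qed.

Lemma charge_integrable_le f g : measurable_fun setT f -> charge_integrable g ->
  (forall x, `|f x| <= `|g x|) -> charge_integrable f.
Proof.
by move=> /measurable_EFinP mf [gP gN] fg; split;
  [apply: le_integrable gP|apply: le_integrable gN] => //= x _; rewrite lee_fin.
Qed.

Lemma eq_charge_integral f g : f =1 g -> charge_integral mu f = charge_integral mu g.
Proof. by move=> /funext ->. Qed.

Lemma charge_integralD f g : charge_integrable f -> charge_integrable g ->
  charge_integral mu (fun x => f x + g x) = charge_integral mu f + charge_integral mu g.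
Proof. by move=> [fP fN] [gP gN]; rewrite /charge_integral !RintegralD//; lra. Qed.

Lemma charge_integralZ (c : R) f : charge_integrable f ->
  charge_integral mu (fun x => c * f x) = c * charge_integral mu f.
Proof. by move=> [fP fN]; rewrite /charge_integral !RintegralZl// mulrBr. Qed.

Lemma charge_integral_dominated_cvg (f_ : nat -> T -> R) f g :
  (forall n, measurable_fun setT (f_ n)) ->
  (forall x, f_ n x @[n --> \oo] --> f x) ->
  charge_integrable g -> (forall n x, `|f_ n x| <= `|g x|) ->
  charge_integral mu (f_ n) @[n --> \oo] --> charge_integral mu f.
Proof.
move=> mf_ f_f [gP gN] fg.
have gabs (m : {measure set T -> \bar R}) :
    m.-integrable setT (EFin \o g) -> m.-integrable setT (EFin \o (fun x => `|g x|)).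
  by move=> /integrable_norm.
by apply: cvgB; apply: (Rintegral_dominated_cvg mf_ f_f _ fg).2; exact: gabs.
Qed.

End charge_integral_theory.

(** * Pseudo-positivity on half-open intervals *)

Section ramp.
Context (R : realType).
Implicit Types (u v t a b : R).

Definition ramp u : R := Num.max 0 (Num.min u 1).

Lemma ramp_ge0 u : 0 <= ramp u. Proof. by rewrite /ramp le_max lexx. Qed.

Lemma ramp_le1 u : ramp u <= 1.
Proof. by rewrite /ramp ge_max ler01 ge_min lexx orbT. Qed.

Lemma ramp_homo : {homo ramp : u v / u <= v}.
Proof. by move=> u v uv; rewrite /ramp le_max2// le_min2. Qed.

Lemma ramp_continuous : continuous ramp.
Proof.
move=> u; apply: (@continuous_max R^o (R^o) (cst 0) (fun u => Num.min u 1)).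
  exact: cvg_cst.
by apply: (@continuous_min _ _ id (cst 1)); [exact: cvg_id|exact: cvg_cst].
Qed.

Lemma ramp_cvg u : ramp (n.+1%:R * u) @[n --> \oo] --> ((0 < u)%R%:R : R).
Proof.
apply/cvgrPdist_lt => e e0; have [u0|u0] := ltP 0 u; last first.
  near=> n; rewrite /ramp (_ : Num.max _ _ = 0) ?subrr ?normr0//.
  by apply/max_idPl; rewrite ge_min mulr_ge0_le0.
near=> n; rewrite /ramp (_ : Num.max _ _ = 1) ?subrr ?normr0//.
rewrite (min_idPr _) ?max_r// -ler_pdivrMr// mul1r.
rewrite (@le_trans _ _ n%:R)// ?ler_nat//.
by near: n; exact: nbhs_infty_ger.
Unshelve. all: by end_near. Qed.

(** Both slopes have length [1 / (n + 1)] and start at [a] and [b], to their right; this makes the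
    limit the indicator of []a, b]] with exactly these end points. *)
Definition trapezoid a b n t := ramp (n.+1%:R * (t - a)) - ramp (n.+1%:R * (t - b)).

Lemma trapezoid_ge0 a b n t : a <= b -> 0 <= trapezoid a b n t.
Proof. by move=> ab; rewrite subr_ge0 ramp_homo// ler_wpM2l// lerB. Qed.

Lemma trapezoid_le1 a b n t : trapezoid a b n t <= 1.
Proof. by rewrite lerBlDr (le_trans (ramp_le1 _))// lerDl ramp_ge0. Qed.

Lemma trapezoid_continuous a b n : continuous (trapezoid a b n).
Proof.
have ramp_comp (c : R) : continuous (fun t => ramp (n.+1%:R * (t - c))).
  move=> t; apply: (@continuous_comp _ _ _ (fun t => n.+1%:R * (t - c)) ramp).
    by apply: cvgM; [exact: cvg_cst|apply: cvgB; [exact: cvg_id|exact: cvg_cst]].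
  exact: ramp_continuous.
by move=> t; apply: cvgB; exact: ramp_comp.
Qed.

(** Slopes are at least 1, so [b + 1] bounds the support for all [n] at once. *)
Lemma trapezoid_supp a b n t : a <= b -> b + 1 <= t -> trapezoid a b n t = 0.
Proof.
move=> ab bt; have ramp1 u : 1 <= u -> ramp u = 1.
  by move=> u1; rewrite /ramp (min_idPr _)// max_r.
have n1 : 1 <= n.+1%:R :> R by rewrite ler1n.
by rewrite /trapezoid !ramp1 ?subrr// mulr_ege1//; lra.
Qed.

Lemma trapezoid_cvg a b t : a <= b ->
  trapezoid a b n t @[n --> \oo] --> (\1_(`]a, b]%classic : set R) t : R).
Proof.
move=> ab; have -> : \1_(`]a, b]%classic : set R) t =
    (0 < t - a)%R%:R - (0 < t - b)%R%:R :> R.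
  rewrite indicE mem_setE in_itv/= !subr_gt0 (leNgt t b).
  by case: (ltP a t) => at_; case: (ltP b t) => bt /=; rewrite ?subrr ?subr0//; lra.
by apply: cvgB; exact: ramp_cvg.
Qed.

End ramp.

Section pseudo_positive_interval.
Context (R : realType) (d : nat).

Definition sqnorm (x : borel_rV R d) : R := enorm x ^+ 2.

Lemma measurable_sqnorm : measurable_fun setT (sqnorm : _ -> measurableTypeR R).
Proof. by apply: measurable_funX; exact: measurable_enorm. Qed.

Lemma sqnorm_ge0 x : 0 <= sqnorm x. Proof. exact: sqr_ge0. Qed.

Lemma pseudo_positive_oc (a : nat -> nat) (Y : forall k, 'I_(a k) -> mpoly d R)
    (mu : {charge set (borel_rV R d) -> \bar R}) (k : nat) (l : 'I_(a k)) (u v : R) :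
  pseudo_positive mu Y -> charge_integrable mu (reval (Y k l)) -> u <= v ->
  0 <= charge_integral mu
    (fun x => \1_(`]u, v]%classic : set R) (sqnorm x) * reval (Y k l) x).
Proof.
move=> mu_pos iY uv; have mY := charge_integrable_measurable iY.
have mtrap n : measurable_fun setT (fun x : borel_rV R d => trapezoid u v n (sqnorm x)).
  apply: (measurableT_comp (f := trapezoid u v n : measurableTypeR R -> R)).
    by apply: continuous_measurable_fun; exact: trapezoid_continuous.
  exact: measurable_sqnorm.
apply: (@cvgr_to_ge _ \oo _ _ (fun n => charge_integral mu
   (fun x => trapezoid u v n (sqnorm x) * reval (Y k l) x))).
  apply: (@charge_integral_dominated_cvg _ _ _ mu
    (fun n x => trapezoid u v n (sqnorm x) * reval (Y k l) x) _ (reval (Y k l))) => //.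
  - by move=> n; exact: measurable_funM.
  - by move=> x; apply: cvgM; [exact: trapezoid_cvg|exact: cvg_cst].
  - move=> n x; rewrite normrM ler_piMl// ger0_norm ?trapezoid_ge0//.
    exact: trapezoid_le1.
(* The square converts between the test functions of |x| in [pseudo_positive] and the variable |x|^2
   used here. *)
near=> n; apply: (mu_pos (fun t => trapezoid u v n (t ^+ 2))).
- apply: continuous_subspaceT => t.
  apply: (@continuous_comp _ _ _ (fun t : R => t ^+ 2) (trapezoid u v n)).
    exact: exprn_continuous.
  exact: trapezoid_continuous.
- by move=> t _; exact: trapezoid_ge0.
(* The radius works because [t >= |v| + 2] forces [t^2 >= v + 1], where the trapezoid vanishes. *)
- apply: (subclosed_compact _ (@segment_compact R 0 (`|v| + 2))).
    exact: closed_closure.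
  rewrite [X in _ `<=` X](closure_id _).1; last exact: itv_closed.
  apply: closure_subset => t [/= /negP t0]; rewrite !in_itv/= andbT => t0'.
  rewrite t0'/= leNgt; apply/negP => tv; apply: t0; apply/eqP.
  apply: trapezoid_supp => //; rewrite expr2.
  have := ler_norm v; nra.
Unshelve. all: by end_near. Qed.

End pseudo_positive_interval.

(** * Evaluation of polynomials and integrability of moments *)

Section evaluation.
Context (R : realType) (d : nat).
Local Notation C := R[i].
Implicit Types (x : borel_rV R d) (f : mpoly d C) (p : mpoly d R).

Lemma ceval_to_cpoly p x : ceval (to_cpoly p) x = (reval p x)%:C%C.
Proof.
rewrite /ceval /to_cpoly /reval; elim/mpolyind: p => [|c m p _ _ IH].
  by rewrite raddf0 !meval0.
rewrite raddfD/= map_mpolyZ map_mpolyX !mevalD !mevalZ IH !mevalX.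
rewrite rmorphD rmorphM rmorph_prod/=; congr (_ * _ + _).
by apply: eq_bigr => i _; rewrite rmorphXn.
Qed.

Lemma sqnormE x : sqnorm x = \sum_(i < d) (x : 'rV[R]_d) 0 i ^+ 2.
Proof. by rewrite /sqnorm /enorm sqr_sqrtr// sumr_ge0// => i _; exact: sqr_ge0. Qed.

Lemma ceval_sqnorm_poly x : ceval (sqnorm_poly R d) x = (sqnorm x)%:C%C.
Proof.
rewrite sqnormE /ceval /sqnorm_poly raddf_sum rmorph_sum; apply: eq_bigr => i _ /=.
by rewrite !rmorphXn/= mevalXU.
Qed.

Lemma ceval_radialXn (m : nat) x :
  ceval (radial_poly d ('X^m : {poly C})) x = (sqnorm x ^+ m)%:C%C.
Proof.
rewrite /radial_poly map_polyXn hornerXn /ceval rmorphXn/= -/(ceval _ x).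
by rewrite ceval_sqnorm_poly [RHS]rmorphXn.
Qed.

Lemma cevalD f g x : ceval (f + g) x = ceval f x + ceval g x.
Proof. exact: mevalD. Qed.

Lemma cevalM f g x : ceval (f * g) x = ceval f x * ceval g x.
Proof. exact: mevalM. Qed.

Lemma cevalZ (c : C) f x : ceval (c *: f) x = c * ceval f x.
Proof. exact: mevalZ. Qed.

Context (mu : {charge set (borel_rV R d) -> \bar R}).
Hypothesis mu_moment : moment_measure mu.

Lemma moment_integrable f :
  charge_integrable mu (fun x => complex.Re (ceval f x)) /\
  charge_integrable mu (fun x => complex.Im (ceval f x)).
Proof. by have [? ?] := mu_moment f; split; exact: charge_integrable_variation. Qed.

Lemma moment_integrable_real p : charge_integrable mu (reval p).
Proof.
have [+ _] := moment_integrable (to_cpoly p).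
by under eq_fun do rewrite ceval_to_cpoly.
Qed.

Lemma moment_integrable_sqnormXM (m : nat) p :
  charge_integrable mu (fun x => sqnorm x ^+ m * reval p x).
Proof.
have [+ _] := moment_integrable (radial_poly d 'X^m * to_cpoly p).
by under eq_fun do rewrite cevalM ceval_radialXn ceval_to_cpoly -rmorphM.
Qed.

Lemma component_Xn (T : {scalar mpoly d C}) p (m : nat) : represents mu T ->
  component T p 'X^m =
  (charge_integral mu (fun x => sqnorm x ^+ m * reval p x))%:C%C.
Proof.
move=> mu_T; rewrite /component mu_T /charge_cintegral.
under eq_charge_integral do rewrite cevalM ceval_radialXn ceval_to_cpoly -rmorphM.
under [X in (_ +i* X)%C]eq_charge_integral
  do rewrite cevalM ceval_radialXn ceval_to_cpoly -rmorphM.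
congr (_ +i* _)%C; rewrite /charge_integral /=.
by rewrite !(Rintegral_cst _ measurableT) !mul0r subrr.
Qed.

End evaluation.

(** * Stieltjes measures of the component functionals *)

Section stieltjes_component.
Context (R : realType) (d : nat) (a : nat -> nat) (Y : forall k, 'I_(a k) -> mpoly d R).
Context (T : {scalar mpoly d R[i]}) (mu : {charge set (borel_rV R d) -> \bar R}).
Hypotheses (mu_moment : moment_measure mu) (mu_pos : pseudo_positive mu Y).
Hypothesis mu_T : represents mu T.
Variables (k : nat) (l : 'I_(a k)).
Local Notation y := (reval (Y l)).

(** The integral formula is kept beside the representation: after determinacy identifies the
    measures of two solutions, it transfers the equality to general weights [g]. *)
Lemma exists_component_measure :
  exists2 tau : {measure set (measurableTypeR R) -> \bar R},
    stieltjes_representing (component T (Y l)) tau &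
    forall g : R -> R, measurable_fun setT (g : measurableTypeR R -> R) ->
      (forall t, 0 <= g t) -> charge_integrable mu (fun x => g (sqnorm x) * y x) ->
      (\int[tau]_t (g t)%:E = (charge_integral mu (fun x => g (sqnorm x) * y x))%:E)%E.
Proof.
have iy : charge_integrable mu y by exact: moment_integrable_real.
have my := charge_integrable_measurable iy.
have [tau tauE] := exists_signed_image (@measurable_sqnorm R d) my iy.1 iy.2
  (fun u v uv => pseudo_positive_oc mu_pos iy uv).
exists tau; last by move=> g mg g0 [gP gN]; exact: tauE.
split.
  have z x : \1_(`]-oo, 0[%classic : set R) (sqnorm x) * y x = 0.
    by rewrite indicE mem_setE in_itv/= ltNge sqnorm_ge0 mul0r.
  have zr (m : {measure set (borel_rV R d) -> \bar R}) :
      \int[m]_x (\1_(`]-oo, 0[%classic : set R) (sqnorm x) * y x) = 0.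
    by under eq_Rintegral do rewrite z; rewrite (Rintegral_cst _ measurableT) mul0r.
  have zi (m : {measure set (borel_rV R d) -> \bar R}) :
      m.-integrable setT (fun x => (\1_(`]-oo, 0[%classic : set R) (sqnorm x) * y x)%:E).
    by under eq_fun do rewrite z; exact: integrable0.
  have := tauE (\1_(`]-oo, 0[%classic : set R)).
  rewrite integral_indic// setIT => ->//; by rewrite !zr subrr.
(* The cut-off at 0 is needed because the formula for [tau] concerns functions nonnegative on the
   whole line, and odd powers are not. *)
move=> m; pose g t : R := \1_(`[0, +oo[%classic : set R) t * t ^+ m.
have mg : measurable_fun setT (g : measurableTypeR R -> R).
  by apply: measurable_funM; [exact: measurable_indic|exact: exprn_measurable].
have g0 t : 0 <= g t.
  rewrite /g indicE mem_setE in_itv/= andbT; case: (leP 0 t) => t0 /=; last by rewrite mul0r.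
  by rewrite mul1r exprn_ge0.
have gs x : g (sqnorm x) * y x = sqnorm x ^+ m * y x.
  by rewrite /g indicE mem_setE in_itv/= sqnorm_ge0 mul1r.
have ig : charge_integrable mu (fun x => g (sqnorm x) * y x).
  by under eq_fun do rewrite gs; exact: moment_integrable_sqnormXM.
have ge t : ((fun t : R => (t ^+ m)%:E) \_ (`[0, +oo[%classic : set R)) t = (g t)%:E.
  rewrite patchE /g indicE; case: (_ \in _); rewrite ?mul1r ?mul0r//.
have gE := tauE g mg g0 ig.1 ig.2.
have gI : tau.-integrable `[0, +oo[ (fun t => (t ^+ m)%:E).
  apply/integrable_mkcond; first exact: measurable_itv.
  rewrite (_ : _ \_ _ = EFin \o g); last by apply/funext => t; exact: ge.
  apply/integrableP; split; first exact/measurable_EFinP.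
  under eq_integral do rewrite gee0_abs ?lee_fin//.
  by rewrite gE ltry.
split=> //.
rewrite (component_Xn (Y l) m mu_T); congr (_%:C)%C.
rewrite /Rintegral integral_mkcond; under eq_integral do rewrite ge.
by rewrite gE/=; under eq_charge_integral do rewrite -gs.
Qed.

End stieltjes_component.

(** * Equality of moments on balls *)

Section ball_moments.
Context (R : realType) (d : nat).
Implicit Types (mu : {charge set (borel_rV R d) -> \bar R}) (f : mpoly d R[i]).

Definition ball_indic (M : R) (x : borel_rV R d) : R :=
  \1_(`[0, M]%classic : set R) (sqnorm x).

Lemma measurable_ball_indic M : measurable_fun setT (ball_indic M).
Proof.
apply: (measurableT_comp (f := \1_(`[0, M]%classic : set R) : measurableTypeR R -> R)).
  exact: measurable_indic.
exact: measurable_sqnorm.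
Qed.

Lemma ball_indic_ge0 M x : 0 <= ball_indic M x.
Proof. by rewrite /ball_indic indicE. Qed.

Lemma ball_indic_le1 M x : ball_indic M x <= 1.
Proof. by rewrite /ball_indic indicE; case: (_ \in _). Qed.

Lemma ball_integrable mu (h : borel_rV R d -> R) M : charge_integrable mu h ->
  charge_integrable mu (fun x => ball_indic M x * h x).
Proof.
move=> ih; apply: charge_integrable_le (ih) _ => [|x].
  apply: measurable_funM; first exact: measurable_ball_indic.
  exact: charge_integrable_measurable ih.
by rewrite normrM ler_piMl// ger0_norm ?ball_indic_ge0// ball_indic_le1.
Qed.

Let wgt M j x : R := ball_indic M x * sqnorm x ^+ j.

Let wgt_integrable mu M j f : moment_measure mu ->
  charge_integrable mu (fun x => wgt M j x * complex.Re (ceval f x)) /\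
  charge_integrable mu (fun x => wgt M j x * complex.Im (ceval f x)).
Proof.
move=> mu_m; have [iR iI] := moment_integrable mu_m (radial_poly d 'X^j * f).
have E x : ceval (radial_poly d 'X^j * f) x = (sqnorm x ^+ j)%:C%C * ceval f x.
  by rewrite cevalM ceval_radialXn.
split.
  have := ball_integrable M iR; congr charge_integrable; apply/funext => x.
  by rewrite E /wgt -mulrA; case: (ceval f x) => u v /=; congr (_ * _); ring.
have := ball_integrable M iI; congr charge_integrable; apply/funext => x.
by rewrite E /wgt -mulrA; case: (ceval f x) => u v /=; congr (_ * _); ring.
Qed.

Context (d_gt0 : (0 < d)%N) (a : nat -> nat) (Y : forall k, 'I_(a k) -> mpoly d R).
Hypothesis Y_basis : forall k, harmonic_orthonormal_basis k (@Y k).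
Context (T : {scalar mpoly d R[i]}).
Hypothesis T_det : forall (k : nat) (l : 'I_(a k)),
  stieltjes_determined (component T (Y l)).
Context (mu nu : {charge set (borel_rV R d) -> \bar R}).
Hypotheses (mu_moment : moment_measure mu) (mu_pos : pseudo_positive mu Y).
Hypothesis mu_T : represents mu T.
Hypotheses (nu_moment : moment_measure nu) (nu_pos : pseudo_positive nu Y).
Hypothesis nu_T : represents nu T.

(** Determinacy enters here: the Stieltjes measures of [mu] and [nu] are the same, hence so are
    their integrals of [t^j] over [[0, M]]. *)
Let component_eq (k : nat) (l : 'I_(a k)) M j :
  charge_integral mu (fun x => wgt M j x * reval (Y l) x) =
  charge_integral nu (fun x => wgt M j x * reval (Y l) x).
Proof.
have [tau0 _ tauU] := T_det l.
have [tm /tauU tm0 tmE] := exists_component_measure mu_moment mu_pos mu_T l.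
have [tn /tauU tn0 tnE] := exists_component_measure nu_moment nu_pos nu_T l.
pose g t : R := \1_(`[0, M]%classic : set R) t * t ^+ j.
have mg : measurable_fun setT (g : measurableTypeR R -> R).
  by apply: measurable_funM; [exact: measurable_indic|exact: exprn_measurable].
have g0 t : 0 <= g t.
  rewrite /g indicE mem_setE in_itv/=; case: (leP 0 t) => t0 /=; last by rewrite mul0r.
  by rewrite mulr_ge0// exprn_ge0.
have ig ch : moment_measure ch ->
    charge_integrable ch (fun x => g (sqnorm x) * reval (Y l) x).
  move=> /wgt_integrable => /(_ M j (to_cpoly (Y l)))[+ _].
  by under eq_fun do rewrite ceval_to_cpoly.
apply: EFin_inj.
transitivity (\int[tm]_t (g t)%:E)%E; first by rewrite tmE//; exact: ig.
transitivity (\int[tn]_t (g t)%:E)%E; last by rewrite tnE//; exact: ig.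
apply: eq_measure_integral => A mA _.
by rewrite [LHS]tm0// [RHS]tn0.
Qed.

(** Quantifying over [j] makes [V] stable under multiplication by |x|^2, which the weight absorbs;
    keeping both parts makes it stable under complex scalars, which mix them. *)
Let V f := forall M j,
  charge_integral mu (fun x => wgt M j x * complex.Re (ceval f x)) =
  charge_integral nu (fun x => wgt M j x * complex.Re (ceval f x)) /\
  charge_integral mu (fun x => wgt M j x * complex.Im (ceval f x)) =
  charge_integral nu (fun x => wgt M j x * complex.Im (ceval f x)).

Let VD f g : V f -> V g -> V (f + g).
Proof.
move=> Vf Vg M j; have [fR fI] := Vf M j; have [gR gI] := Vg M j.
have [fmR fmI] := wgt_integrable M j f mu_moment.
have [gmR gmI] := wgt_integrable M j g mu_moment.
have [fnR fnI] := wgt_integrable M j f nu_moment.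
have [gnR gnI] := wgt_integrable M j g nu_moment.
have ER x : wgt M j x * complex.Re (ceval (f + g) x) =
    wgt M j x * complex.Re (ceval f x) + wgt M j x * complex.Re (ceval g x).
  by rewrite cevalD -mulrDr; case: (ceval f x) (ceval g x) => [? ?] [].
have EI x : wgt M j x * complex.Im (ceval (f + g) x) =
    wgt M j x * complex.Im (ceval f x) + wgt M j x * complex.Im (ceval g x).
  by rewrite cevalD -mulrDr; case: (ceval f x) (ceval g x) => [? ?] [].
rewrite !(eq_charge_integral _ ER) !(eq_charge_integral _ EI).
by rewrite !charge_integralD// fR fI gR gI.
Qed.

Let VZ (c : R[i]) f : V f -> V (c *: f).
Proof.
move=> Vf M j; have [fR fI] := Vf M j.
have [fmR fmI] := wgt_integrable M j f mu_moment.
have [fnR fnI] := wgt_integrable M j f nu_moment.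
case: c => u v.
have ER x : wgt M j x * complex.Re (ceval ((u +i* v)%C *: f) x) =
    u * (wgt M j x * complex.Re (ceval f x)) +
    (- v) * (wgt M j x * complex.Im (ceval f x)).
  by rewrite cevalZ; case: (ceval f x) => ? ? /=; ring.
have EI x : wgt M j x * complex.Im (ceval ((u +i* v)%C *: f) x) =
    u * (wgt M j x * complex.Im (ceval f x)) + v * (wgt M j x * complex.Re (ceval f x)).
  by rewrite cevalZ; case: (ceval f x) => ? ? /=; ring.
rewrite !(eq_charge_integral _ ER) !(eq_charge_integral _ EI).
by rewrite !charge_integralD ?charge_integralZ ?fR ?fI//; exact: charge_integrableZ.
Qed.

Let Vq f : V f -> V (sqnorm_poly R d * f).
Proof.
move=> Vf M j; have [fR fI] := Vf M j.+1.
have ER x : wgt M j x * complex.Re (ceval (sqnorm_poly R d * f) x) =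
    wgt M j.+1 x * complex.Re (ceval f x).
  by rewrite cevalM ceval_sqnorm_poly /wgt exprSr; case: (ceval f x) => ? ? /=; ring.
have EI x : wgt M j x * complex.Im (ceval (sqnorm_poly R d * f) x) =
    wgt M j.+1 x * complex.Im (ceval f x).
  by rewrite cevalM ceval_sqnorm_poly /wgt exprSr; case: (ceval f x) => ? ? /=; ring.
by rewrite !(eq_charge_integral _ ER) !(eq_charge_integral _ EI).
Qed.

Let integral_wgt0 ch M j (h : borel_rV R d -> R) : moment_measure ch ->
  (forall x, h x = 0) -> charge_integral ch (fun x => wgt M j x * h x) = 0.
Proof.
move=> ch_moment h0; have [i0 _] := wgt_integrable M j 0 ch_moment.
rewrite (eq_charge_integral _ (g := fun x => 0 * (wgt M j x * complex.Re (ceval 0 x)))).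
  by rewrite charge_integralZ// mul0r.
by move=> x; rewrite h0 mulr0 mul0r.
Qed.

Let V0 : V 0.
Proof. by move=> M j; rewrite !integral_wgt0// => x; rewrite /ceval meval0. Qed.

Let V_Y (k : nat) (l : 'I_(a k)) : V (to_cpoly (Y l)).
Proof.
move=> M j; split; last by rewrite !integral_wgt0// => x; rewrite ceval_to_cpoly.
by under eq_charge_integral do rewrite ceval_to_cpoly/=;
  under [RHS]eq_charge_integral do rewrite ceval_to_cpoly/=; exact: component_eq.
Qed.

Lemma ball_moment_eq M (p : mpoly d R) :
  charge_integral mu (fun x => ball_indic M x * reval p x) =
  charge_integral nu (fun x => ball_indic M x * reval p x).
Proof.
have [|+ _] := @harmonic_ind R d d_gt0 V VD VZ Vq _ (to_cpoly p) M 0.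
  move=> k f hf; have [_ /(_ f hf)[c ->] _ _] := Y_basis k.
  by elim/big_ind : _ => // l _; exact/VZ/V_Y.
have E x : wgt M 0 x * complex.Re (ceval (to_cpoly p) x) = ball_indic M x * reval p x.
  by rewrite ceval_to_cpoly /wgt expr0 mulr1.
by rewrite !(eq_charge_integral _ E).
Qed.

End ball_moments.

(** * Polynomials converging to a step function on the unit interval *)

Section polynomial_step.
Context (R : realType).
Implicit Types (t h : R) (n : nat).

Lemma bernoulli_ineq h n : -1 <= h -> 1 + n%:R * h <= (1 + h) ^+ n.
Proof.
move=> h1; elim: n => [|n IH]; first by rewrite mul0r addr0 expr0.
rewrite exprS; apply: (@le_trans _ _ ((1 + h) * (1 + n%:R * h))).
  by rewrite -natr1; have := ler0n R n; nra.
by rewrite ler_wpM2l//; lra.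
Qed.

(** A variant of the polynomials [(1 - t^n)^(k^n)] from elementary proofs of the Stone-Weierstrass
    theorem. The product of the outer exponent with [t^(2n)] is [n (2t)^(2n)]: it tends to 0 for
    [t < 1/2] and is at least [n] for [t >= 1/2], the factor [n] settling the threshold itself. *)
Definition poly_step n t : R := (1 - t ^+ (2 * n)) ^+ (n * 4 ^ n).

Lemma poly_step_bound n t : 0 <= t <= 1 -> 0 <= poly_step n t <= 1.
Proof.
move=> /andP[t0 t1]; have tn0 : 0 <= t ^+ (2 * n) by rewrite exprn_ge0.
have tn1 : t ^+ (2 * n) <= 1 by rewrite exprn_ile1.
by rewrite /poly_step exprn_ge0 ?exprn_ile1//; lra.
Qed.

Let weightE n t : (n * 4 ^ n)%:R * t ^+ (2 * n) = n%:R * ((2 * t) ^+ n) ^+ 2 :> R.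
Proof.
rewrite natrM natrX -mulrA exprM -exprMn -exprM mulnC exprM; congr (_ * _ ^+ _).
by rewrite exprMn -natrX.
Qed.

Lemma poly_step_ge n t : 0 <= t < 2^-1 ->
  1 - harmonic n / (1 - 2 * t) ^+ 2 <= poly_step n t.
Proof.
move=> /andP[t0 t2]; set h := 1 - 2 * t; have h0 : 0 < h by rewrite /h; lra.
have tn1 : t ^+ (2 * n) <= 1 by rewrite exprn_ile1//; lra.
have := @bernoulli_ineq (- t ^+ (2 * n)) (n * 4 ^ n).
rewrite lerN2 => /(_ tn1); apply: le_trans.
rewrite mulrN weightE lerD2l lerN2.
(* Since [2 * t = 1 - h], this follows from [(n + 1) h <= 1 + n h <= (1 + h)^n] and
   [(1 - h^2)^n <= 1]. Its square gains [(n + 1)^-2], enough to beat the factor [n] from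
   Bernoulli. *)
have un : (2 * t) ^+ n * (n.+1%:R * h) <= 1.
  apply: (@le_trans _ _ ((2 * t) ^+ n * (1 + h) ^+ n)).
    rewrite ler_wpM2l ?exprn_ge0//; first lra.
    have h1 : -1 <= h by lra.
    apply: le_trans (bernoulli_ineq n h1); rewrite -natr1 mulrDl mul1r addrC lerD2r.
    by rewrite /h; lra.
  by rewrite -exprMn exprn_ile1//; rewrite /h; nra.
have v0 : 0 <= (2 * t) ^+ n by rewrite exprn_ge0//; lra.
have n0 : 0 < n.+1%:R :> R by [].
rewrite ler_pdivlMr ?exprn_gt0// /harmonic -[leRHS]mul1r ler_pdivlMr//.
apply: (@le_trans _ _ (((2 * t) ^+ n * (n.+1%:R * h)) ^+ 2)); last first.
  by rewrite exprn_ile1// mulr_ge0// mulr_ge0// ltW.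
have -> : ((2 * t) ^+ n * (n.+1%:R * h)) ^+ 2 =
    n.+1%:R * ((2 * t) ^+ n) ^+ 2 * h ^+ 2 * n.+1%:R by ring.
by rewrite !ler_wpM2r ?exprn_ge0 ?ler_nat//; lra.
Qed.

(** With [N] the outer exponent, [(1 - e)^N (1 + e)^N <= 1], and Bernoulli gives
    [(1 + e)^N >= 1 + N e >= n + 1]. *)
Lemma poly_step_le n t : 2^-1 <= t <= 1 -> poly_step n t <= harmonic n.
Proof.
move=> /andP[t2 t1]; set e := t ^+ (2 * n).
have e0 : 0 <= e by rewrite exprn_ge0//; lra.
have e1 : e <= 1 by rewrite exprn_ile1//; lra.
rewrite /harmonic -[leRHS]mul1r ler_pdivlMr//.
have le1 : -1 <= e by lra.
have nle : n.+1%:R <= (1 + e) ^+ (n * 4 ^ n) :> R.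
  apply: le_trans (bernoulli_ineq _ le1); rewrite weightE -natr1 addrC lerD2l.
  by rewrite ler_peMr// exprn_ege1// exprn_ege1//; lra.
apply: (@le_trans _ _ (poly_step n t * (1 + e) ^+ (n * 4 ^ n))).
  by rewrite ler_wpM2l// exprn_ge0//; rewrite -/e; lra.
by rewrite /poly_step -exprMn exprn_ile1//; rewrite -/e; nra.
Qed.

Lemma poly_step_cvg t : 0 <= t <= 1 ->
  poly_step n t @[n --> \oo] --> ((t < 2^-1)%R%:R : R).
Proof.
move=> t01; have /andP[t0 t1] := t01; have [t2|t2] := ltP t 2^-1.
  apply: (squeeze_cvgr (f := fun n => 1 - harmonic n / (1 - 2 * t) ^+ 2) (h := cst 1)).
  - near=> n; rewrite poly_step_ge ?t0//=.
    by have /andP[] := poly_step_bound n t01.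
  - rewrite -[X in _ --> X]subr0 -(mul0r ((1 - 2 * t) ^+ 2)^-1).
    apply: cvgB; first exact: cvg_cst.
    by apply: cvgM; [exact: cvg_harmonic|exact: cvg_cst].
  - exact: cvg_cst.
apply: (squeeze_cvgr (f := cst 0) (h := harmonic)).
- near=> n; rewrite poly_step_le ?t2// andbT.
  by have /andP[] := poly_step_bound n t01.
- exact: cvg_cst.
- exact: cvg_harmonic.
Unshelve. all: by end_near. Qed.

End polynomial_step.

(** * Cutting a weight by a half-space *)

Section half_spaces.
Context (R : realType) (d : nat).
Local Notation X := (borel_rV R d).
Context (mu nu : {charge set X -> \bar R}).
Hypotheses (mu_moment : moment_measure mu) (nu_moment : moment_measure nu).

(** As [p] is arbitrary, a polynomial factor of the weight can be moved into [p]. *)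
Definition same_moments (w : X -> R) := forall p : mpoly d R,
  charge_integral mu (fun x => w x * reval p x) =
  charge_integral nu (fun x => w x * reval p x).

Definition half_space (ic : 'I_d * R) : set X := [set x | (x : 'rV[R]_d) 0 ic.1 < ic.2].

Lemma measurable_half_space ic : measurable (half_space ic).
Proof.
rewrite (_ : half_space ic = (fun x : X => (x : 'rV[R]_d) 0 ic.1) @^-1` `]-oo, ic.2[).
  rewrite -[X in measurable X]setTI; apply: (@measurable_coord_rV R d ic.1) => //.
by apply/seteqP; split => x; rewrite /= in_itv.
Qed.

(* With [q] an affine function of the [i]-th coordinate scaled into [[0, 1]] on the
   support of [w], [poly_step n q] is again a polynomial, so [w] may be multiplied
   by it; the limit is the indicator of [q < 1/2]. *)
Lemma same_moments_half_space (w : X -> R) (M : R) ic :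
  measurable_fun setT w -> (forall x, 0 <= w x <= 1) ->
  (forall x, M < sqnorm x -> w x = 0) ->
  same_moments w -> same_moments (fun x => w x * \1_(half_space ic) x).
Proof.
move=> mw w01 wM sw p; case: ic => i c.
(* On the support of [w], [x_i^2 <= |M|] gives [|x_i| <= 1 + |M|], so [|x_i - c| <= B]; dividing by
   [2 * B] and shifting by 1/2 lands in [[0, 1]], with [x_i = c] at the threshold. *)
pose B : R := 1 + `|M| + `|c|.
have B0 : 0 < B by rewrite /B; have := normr_ge0 M; have := normr_ge0 c; lra.
pose q : mpoly d R := (2 * B)^-1 *: mpolyX R (mnm1 i) + mpolyC d (2^-1 - c / (2 * B)).
have qE (x : X) : reval q x = 2^-1 + ((x : 'rV[R]_d) 0 i - c) / (2 * B).
  by rewrite /reval mevalD mevalZ mevalXU mevalC; field; rewrite gt_eqF.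
have q01 x : sqnorm x <= M -> 0 <= reval q x <= 1.
  move=> xM; have xi : `|(x : 'rV[R]_d) 0 i| <= 1 + `|M|.
    have : (x : 'rV[R]_d) 0 i ^+ 2 <= `|M|.
      apply: le_trans (le_trans xM (ler_norm M)).
      by rewrite sqnormE (bigD1 i)//= lerDl sumr_ge0// => j _; exact: sqr_ge0.
    have M1 : 0 <= 1 + `|M| by rewrite addr_ge0.
    move=> xi2; rewrite -ler_sqr ?nnegrE// real_normK ?num_real//.
    apply: le_trans xi2 _.
    by have := normr_ge0 M; nra.
  rewrite qE; have xc : `|(x : 'rV[R]_d) 0 i - c| <= B.
    by rewrite /B (le_trans (ler_normB _ _))// lerD2r.
  have : `|((x : 'rV[R]_d) 0 i - c) / (2 * B)| <= 2^-1.
    rewrite normrM [X in _ * X]ger0_norm ?invr_ge0 ?mulr_ge0 ?(ltW B0)//.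
    by rewrite ler_pdivrMr ?mulr_gt0// mulKf.
  by rewrite ler_norml; lra.
have qlt x : (reval q x < 2^-1) = (x \in half_space (i, c)).
  rewrite qE gtrDl pmulr_llt0 ?invr_gt0 ?mulr_gt0// subr_lt0.
  by apply/idP/idP => [xc|/set_mem//]; exact/mem_set.
pose Q n : mpoly d R := (1 - q ^+ (2 * n)) ^+ (n * 4 ^ n) * p.
have QE n x : reval (Q n) x = poly_step n (reval q x) * reval p x.
  by rewrite /reval mevalM rmorphXn/= mevalB meval1 rmorphXn.
have lim (ch : {charge set X -> \bar R}) : moment_measure ch ->
    charge_integral ch (fun x => w x * reval (Q n) x) @[n --> \oo] -->
    charge_integral ch (fun x => w x * \1_(half_space (i, c)) x * reval p x).
  move=> ch_moment; have ip := moment_integrable_real ch_moment p.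
  apply: (@charge_integral_dominated_cvg _ _ _ ch
    (fun n x => w x * reval (Q n) x) _ (reval p)) => //.
  - move=> n; apply: measurable_funM => //.
    exact: charge_integrable_measurable (moment_integrable_real ch_moment (Q n)).
  - move=> x; under eq_cvg do rewrite QE mulrA.
    apply: cvgM; last exact: cvg_cst.
    have [xM|Mx] := leP (sqnorm x) M; last first.
      by under eq_cvg do rewrite wM// mul0r; rewrite wM// mul0r; exact: cvg_cst.
    apply: cvgM; first exact: cvg_cst.
    by rewrite indicE -qlt; apply: poly_step_cvg; exact: q01.
  (* Outside the ball [poly_step] is uncontrolled, but there [w] vanishes; inside, the factor before
     [p] is at most 1. *)
  - move=> n x; rewrite QE mulrA normrM ler_piMl// normrM.
    have [xM|Mx] := leP (sqnorm x) M; last by rewrite wM// normr0 mul0r.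
    have /andP[w0 w1] := w01 x; have /andP[s0 s1] := poly_step_bound n (q01 x xM).
    by rewrite !ger0_norm// mulr_ile1.
have := lim mu mu_moment.
rewrite (_ : (fun n => _) = fun n => charge_integral nu (fun x => w x * reval (Q n) x)).
  by move=> /cvg_unique; apply => //; exact: lim.
by apply/funext => n; exact: sw.
Qed.

End half_spaces.

(** * A pi-system generating the Borel sets *)

Section ball_boxes.
Context (R : realType) (d : nat).
Local Notation X := (borel_rV R d).

(** Every member keeps a ball, since the polynomial approximation requires a weight of bounded
    support. *)
Fixpoint ball_box (M : R) (s : seq ('I_d * R)) : set X :=
  if s is ic :: s' then ball_box M s' `&` half_space ic
  else @sqnorm R d @^-1` `[0, M].

Definition ball_boxes : set (set X) := [set ball_box M s | M in setT & s in setT].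

Lemma measurable_ball_box M s : measurable (ball_box M s).
Proof.
elim: s => [|ic s IH]/=; last exact: measurableI IH (measurable_half_space _).
by rewrite -[X in measurable X]setTI; apply: measurable_sqnorm.
Qed.

Lemma ball_boxI M N s t : ball_box M s `&` ball_box N t = ball_box (Num.min M N) (s ++ t).
Proof.
elim: s => [|ic s IH]/=; last by rewrite setIAC IH.
elim: t => [|ic t IH]/=; last by rewrite setIA IH.
by apply/seteqP; split => x/=; rewrite !in_itv/= !sqnorm_ge0/= le_min => /andP.
Qed.

Lemma setI_closed_ball_boxes : setI_closed ball_boxes.
Proof.
move=> _ _ [M _ [s _ <-]] [N _ [t _ <-]].
by rewrite ball_boxI; exists (Num.min M N) => //; exists (s ++ t).
Qed.

Lemma bigcup_ball : \bigcup_n ball_box n%:R [::] = setT.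
Proof.
apply/seteqP; split => // x _; exists (Num.bound (sqnorm x)) => //=.
by rewrite in_itv/= sqnorm_ge0/= ltW// archi_boundP// sqnorm_ge0.
Qed.

(** Half-spaces are countable unions of members, so coordinates are measurable for the generated
    sigma-algebra; hence so is the identity into the Borel space. *)
Lemma borel_ball_boxes (A : set X) : measurable A -> <<s ball_boxes >> A.
Proof.
have hs ic : <<s ball_boxes >> (half_space ic).
  rewrite (_ : half_space ic =
    \bigcup_n (ball_box n%:R [::] `&` half_space ic)); last first.
    by rewrite -setI_bigcupl bigcup_ball setTI.
  apply: (@bigcupT_measurable _ (g_sigma_algebraType ball_boxes)) => n.
  by apply: sub_sigma_algebra; exists n%:R => //; exists [:: ic].
have mid : measurable_fun setT (id : g_sigma_algebraType ball_boxes -> X).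
  apply: measurable_fun_rVP => i mT.
  apply: (measurability _ (RGenInftyO.measurableE R)) => //.
  move=> _ [_ [c ->] <-]; rewrite setTI.
  rewrite (_ : _ @^-1` _ = half_space (i, c)); first exact: hs.
  by apply/seteqP; split => x; rewrite /= in_itv.
by move=> mA; have := mid measurableT A mA; rewrite setTI.
Qed.

End ball_boxes.

(** * Uniqueness for charges and conclusion *)

Section charge_eq.
Context (R : realType) (d : nat).
Local Notation X := (borel_rV R d).
Context (mu nu : {charge set X -> \bar R}).

Local Notation pos ch := (jordan_pos (svalP (hahn_sig ch))).
Local Notation neg ch := (jordan_neg (svalP (hahn_sig ch))).

Let jordan (ch : {charge set X -> \bar R}) (A : set X) : measurable A ->
  (ch A = (fine (pos ch A) - fine (neg ch A))%:E)%E.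
Proof.
move=> mA; rewrite (jordan_decomp (svalP (hahn_sig ch)) mA) /cadd /cscale/=.
rewrite EFinB !fineK ?fin_num_measure//; congr (_ + _)%E; exact: mulN1e.
Qed.

Lemma charge_integral_indic (ch : {charge set X -> \bar R}) (A : set X) :
  measurable A -> ((charge_integral ch \1_A)%:E = ch A)%E.
Proof.
by move=> mA; rewrite jordan// /charge_integral /Rintegral !integral_indic// !setIT.
Qed.

(** Moving the negative Jordan parts across the equality turns it into one between finite
    nonnegative measures, to which uniqueness on a pi-system applies. *)
Lemma charge_eq_ball_boxes :
  (forall A, ball_boxes A -> mu A = nu A) -> forall A, measurable A -> mu A = nu A.
Proof.
move=> eqG.
pose m1 : {measure set X -> \bar R} := measure_add (pos mu) (neg nu).
pose m2 : {measure set X -> \bar R} := measure_add (neg mu) (pos nu).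
have m12 (A : set X) : measurable A -> (m1 A = m2 A)%E <-> mu A = nu A.
  move=> mA.
  have m1E : m1 A = (fine (pos mu A) + fine (neg nu A))%:E.
    by rewrite [LHS]measure_addE EFinD !fineK ?fin_num_measure.
  have m2E : m2 A = (fine (neg mu A) + fine (pos nu A))%:E.
    by rewrite [LHS]measure_addE EFinD !fineK ?fin_num_measure.
  by rewrite m1E m2E (jordan mu mA) (jordan nu mA); split => -[E]; congr EFin; lra.
have mG : @ball_boxes R d `<=` measurable.
  by move=> _ [M _ [s _ <-]]; exact: measurable_ball_box.
move=> A mA; apply/m12 => //.
apply: (@g_sigma_algebra_measure_unique _ R X (@ball_boxes R d) mG
  (fun n => ball_box n%:R [::]) _ _ m1 m2); last exact: borel_ball_boxes.
- by move=> n; exists n%:R => //; exists [::].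
- exact: bigcup_ball.
- exact: setI_closed_ball_boxes.
- by move=> B GB; apply/m12; [exact: mG|exact: eqG].
- move=> n; rewrite [ltLHS]measure_addE lte_add_pinfty// -ge0_fin_numE//;
    apply: fin_num_measure; exact: measurable_ball_box.
Qed.

Lemma same_moments_ball_box :
  moment_measure mu -> moment_measure nu ->
  (forall M, same_moments mu nu (ball_indic M)) ->
  forall M s, same_moments mu nu (\1_(ball_box M s)).
Proof.
move=> mu_m nu_m sM M; elim => [|ic s IH].
  move=> p; rewrite (_ : \1_(ball_box M [::]) = ball_indic M); first exact: sM.
  by apply/funext => x; rewrite /ball_indic !indicE.
rewrite (_ : \1_(ball_box M (ic :: s)) =
    fun x => \1_(ball_box M s) x * \1_(half_space ic) x); last first.
  by rewrite /= indicI.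
apply: (@same_moments_half_space _ _ _ _ mu_m nu_m _ M) => //.
- by apply: measurable_indic; exact: measurable_ball_box.
- by move=> x; rewrite indicE; case: (_ \in _); rewrite ?lexx ?ler01.
- move=> x Mx; rewrite indicE memNset//=; elim: s {IH} => /= [|ic' s IH].
    by rewrite in_itv/= (lt_geF Mx) andbF.
  by move=> [].
Qed.

End charge_eq.

Theorem theorem17 (R : realType) (d : nat) (d_ge2 : (2 <= d)%N)
    (a : nat -> nat) (Y : forall k : nat, 'I_(a k) -> mpoly d R)
    (Y_basis : forall k : nat, harmonic_orthonormal_basis k (Y k))
    (T : {scalar mpoly d R[i]})
    (T_pos : pseudo_positive_definite Y T)
    (T_det : forall (k : nat) (l : 'I_(a k)),
      stieltjes_determined (component T (Y k l)))
    (mu nu : {charge set (borel_rV R d) -> \bar R})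
    (mu_moment : moment_measure mu) (mu_pos : pseudo_positive mu Y)
    (mu_T : represents mu T)
    (nu_moment : moment_measure nu) (nu_pos : pseudo_positive nu Y)
    (nu_T : represents nu T) :
  forall A : set (borel_rV R d), measurable A -> mu A = nu A.
Proof.
apply: charge_eq_ball_boxes => _ [M _ [s _ <-]].
have mB := measurable_ball_box M s.
rewrite -!charge_integral_indic//; congr EFin.
have sM M' : same_moments mu nu (ball_indic M').
  by move=> p; apply: (ball_moment_eq _ Y_basis T_det) => //; exact: leq_trans d_ge2.
(* At [p = 1] the moment is the integral of the indicator, that is, the mass. *)
have := same_moments_ball_box mu_moment nu_moment sM M s 1.
by under eq_charge_integral do rewrite /reval meval1 mulr1;
  under [RHS]eq_charge_integral do rewrite /reval meval1 mulr1.
Qed.
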